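(* Let $I$ be a monomial ideal in $R=K[x_1,\ldots,x_n]$. Then $I$ is a Lyubeznik ideal if and only if $TObsL(I)=0$.
   Context: $K$ is a field and $G(I)$ denotes the minimal set of monomial generators of $I$. For a total order $\prec$ on $G(I)$ write $G(I)=\{m_1\prec\cdots\prec m_\mu\}$. For $A\subseteq G(I)$, $\mathrm{lcm}(A)$ is the least common multiple of the elements of $A$ and $\min(A)$ its least element under $\prec$. A subset $C\subseteq G(I)$ is a cover of $u\in C$ if $u\mid\mathrm{lcm}(C-\{u\})$; it is an $E$-minimal cover of $u$ if moreover no proper subset of $C$ is a cover of $u$. Let $\mathcal{C}_E(I)$ be the family of all subsets $A\subseteq G(I)$ that are $E$-minimal covers (of some $u\in A$). A (nonempty) subset $D\subseteq G(I)$ is broken under $\prec$ if there is $u\in G(I)$ with $u\mid\mathrm{lcm}(D)$ and $u\prec\min(D)$. A subset $E\subseteq G(I)$ is preserved under $\prec$ if no subset of $E$ is broken. The obstruction of Lyubeznik with respect to $\prec$ is $ObsL(I,\prec)=\max\{|A|: A\in\mathcal{C}_E(I),\ A\text{ is preserved under }\prec\}$, with $ObsL(I,\prec)=0$ if this set is empty. The total obstruction of Lyubeznik is $TObsL(I)=\min\{ObsL(I,\prec):\prec\text{ is a total order on }G(I)\}$. Lyubeznik resolution with respect to $\prec$: a symbol is $u(i_1;\ldots;i_t)$ with $1\le i_1<\cdots<i_t\le\mu$; it is $L$-admissible (of dimension $t$) if for all $h<t$ and all $q<i_h$, $m_q$ does not divide $\mathrm{lcm}(m_{i_h},\ldots,m_{i_t})$.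 The Lyubeznik resolution is the free resolution of $R/I$ with $L^0=R$, $L^t$ the free $R$-module on the $L$-admissible symbols of dimension $t$, and $$\partial_t(u(i_1;\ldots;i_t))=\sum_{j=1}^t(-1)^{j+1}\frac{\mathrm{lcm}(m_{i_1},\ldots,m_{i_t})}{\mathrm{lcm}(m_{i_1},\ldots,\widehat{m_{i_j}},\ldots,m_{i_t})}\,u(i_1;\ldots;\widehat{i_j};\ldots;i_t).$$ $I$ is a Lyubeznik ideal if there is a total order on $G(I)$ for which the corresponding Lyubeznik resolution is a minimal free resolution of $R/I$. *)

(* Defs.v *)
From Stdlib Require Import Classical ClassicalEpsilon.
From HB Require Import structures.
From mathcomp Require Import all_boot all_order all_algebra.
From mathcomp Require Import finmap mpoly.

Set Implicit Arguments.
Unset Strict Implicit.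
Unset Printing Implicit Defensive.

Import GRing.Theory.

Local Open Scope ring_scope.
Local Open Scope fset_scope.

Definition span (R : comNzRingType) (V : lmodType R) (S : V -> Prop) (x : V)
    : Prop :=
  exists s : seq (R * V),
    (forall p, p \in s -> S p.2) /\ x = \sum_(p <- s) p.1 *: p.2.

Definition ideal_gen (R : comNzRingType) (S : R -> Prop) : R -> Prop :=
  @span R R^o S.

Definition ideal_smul (R : comNzRingType) (J : R -> Prop) (V : lmodType R)
    : V -> Prop :=
  span (fun y : V => exists (a : R) (v : V), J a /\ y = a *: v).

(* F_t is the free module on the finite set [B t]; [R/I] is handled through
   its lift to R: [aug : F_0 -> R] followed by the projection R -> R/I is the
   augmentation. *)
Definition free_resolution_of_quotient (R : comNzRingType) (I : R -> Prop)
    (B : nat -> finType)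
    (aug : {ffun B 0%N -> R^o} -> R^o)
    (d : forall t, {ffun B t.+1 -> R^o} -> {ffun B t -> R^o}) : Prop :=
  [/\ linear aug /\ (forall t, linear (d t)),
      forall a : R, exists x, I (a - aug x),
      forall x, I (aug x) <-> exists y, x = d 0%N y
    & forall t x, d t x = 0 <-> exists y, x = d t.+1 y].

(* [mm] is the irrelevant maximal ideal. *)
Definition minimal_free_resolution_of_quotient (R : comNzRingType)
    (mm I : R -> Prop) (B : nat -> finType)
    (aug : {ffun B 0%N -> R^o} -> R^o)
    (d : forall t, {ffun B t.+1 -> R^o} -> {ffun B t -> R^o}) : Prop :=
  free_resolution_of_quotient I aug d /\
  forall t x, ideal_smul mm (d t x).

(* A monomial is represented by its exponent vector m : 'X_{1..n}. *)

Section MonomialIdeals.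
Variables (K : fieldType) (n : nat).

Definition monomials_of (S : 'X_{1..n} -> Prop) (p : {mpoly K[n]}) : Prop :=
  exists2 m, S m & p = 'X_[m].

Definition generates (S : 'X_{1..n} -> Prop) (I : {mpoly K[n]} -> Prop) : Prop :=
  forall p, I p <-> ideal_gen (monomials_of S) p.

Definition monomial_ideal (I : {mpoly K[n]} -> Prop) : Prop :=
  exists S : 'X_{1..n} -> Prop, generates S I.

Definition irrelevant_ideal : {mpoly K[n]} -> Prop :=
  ideal_gen (fun p => exists i : 'I_n, p = 'X_i).

Definition minimal_generating_set (I : {mpoly K[n]} -> Prop)
    (G : {fset 'X_{1..n}}) : Prop :=
  generates (fun m => m \in G) I /\
  forall G' : {fset 'X_{1..n}}, G' `<` G -> ~ generates (fun m => m \in G') I.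

(* G(I): for a monomial ideal, the set chosen here exists and is unique,
   see mingensP and minimal_generating_set_unique. *)
Definition mingens (I : {mpoly K[n]} -> Prop) : {fset 'X_{1..n}} :=
  epsilon (inhabits fset0) (minimal_generating_set I).

End MonomialIdeals.

(* A total order is given by the graph of its strict relation, so that the
   total orders on T form a finite type. *)

Section Orders.
Variable T : finType.
Implicit Type r : {set T * T}.

Definition prec r : rel T := fun x y => (x, y) \in r.

Definition total_order r : bool :=
  [&& [forall x, ~~ prec r x x],
      [forall x, forall y, forall z, prec r x y && prec r y z ==> prec r x z]
    & [forall x, forall y, (x != y) ==> prec r x y || prec r y x]].

Definition is_min r (D : {set T}) (d : T) : bool :=
  (d \in D) && [forall e in D, (e == d) || prec r d e].

Lemma total_order_exists : exists r, total_order r.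
Proof.
exists [set p : T * T | (enum_rank p.1 < enum_rank p.2)%N].
apply/and3P; split.
- by apply/forallP => x; rewrite /prec inE ltnn.
- apply/forallP => x; apply/forallP => y; apply/forallP => z; rewrite /prec !inE /=.
  by apply/implyP => /andP[]; apply: ltn_trans.
- apply/forallP => x; apply/forallP => y; rewrite /prec !inE /=.
  by apply/implyP => xy; rewrite -neq_ltn (inj_eq val_inj) (inj_eq enum_rank_inj).
Qed.

End Orders.

(* Divisibility of monomials is the pointwise order (_ <= _)%MM. *)

Section Obstruction.
Variables (n : nat) (G : {fset 'X_{1..n}}).
Implicit Types (A C D E : {set G}) (u : G) (r : {set G * G}).

Definition lcm_set A : 'X_{1..n} := \big[@mlcm n/0%MM]_(u in A) val u.

Definition cover C u : bool := (u \in C) && (val u <= lcm_set (C :\ u))%MM.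

Definition Eminimal_cover C u : bool :=
  cover C u && [forall C' : {set G}, (C' \proper C) ==> ~~ cover C' u].

Definition CE A : bool := [exists u, Eminimal_cover A u].

Definition broken r D : bool :=
  [exists d, is_min r D d && [exists u, (val u <= lcm_set D)%MM && prec r u d]].

Definition preserved r E : bool :=
  [forall D : {set G}, (D \subset E) ==> ~~ broken r D].

(* \max over the empty family is 0. *)
Definition ObsL r : nat := \max_(A : {set G} | CE A && preserved r A) #|A|.

Lemma ObsL_exists :
  exists k, [exists r : {set G * G}, total_order r && (ObsL r == k)].
Proof.
have [r hr] := total_order_exists G.
by exists (ObsL r); apply/existsP; exists r; rewrite hr eqxx.
Qed.

Definition TObsL : nat := ex_minn ObsL_exists.

End Obstruction.

(* The symbol u(i_1;...;i_t) is encoded by the tuple (m_{i_1},...,m_{i_t}),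
   which increases for the order r. *)

Section Lyubeznik.
Variables (K : fieldType) (n : nat) (G : {fset 'X_{1..n}}) (r : {set G * G}).
Local Notation R := {mpoly K[n]}.

Definition lcm_seq (s : seq G) : 'X_{1..n} := \big[@mlcm n/0%MM]_(u <- s) val u.

(* Here h counts from 0, so h < t of the 1-based convention is h.+1 < t. *)
Definition L_admissible t (s : t.-tuple G) : bool :=
  sorted (prec r) s &&
  [forall h : 'I_t, forall v : G,
    (h.+1 < t)%N && prec r v (tnth s h) ==> ~~ (val v <= lcm_seq (drop h s))%MM].

Definition Lsymb (t : nat) : finType := {s : t.-tuple G | L_admissible s}.

Definition Lmod (t : nat) : lmodType R := {ffun Lsymb t -> R^o}.

(* The basis element of the symbol s (0 if s is not an admissible symbol of
   dimension t, which does not happen for the faces used in Ldiff). *)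
Definition Lbasis t (s : seq G) : Lmod t :=
  [ffun b : Lsymb t => (tval (val b) == s)%:R].

Definition omit (j : nat) (s : seq G) : seq G := take j s ++ drop j.+1 s.

Definition Ldiff_basis t (b : Lsymb t.+1) : Lmod t :=
  let s := tval (val b) in
  \sum_(j < t.+1)
    ((-1) ^+ j * 'X_[(lcm_seq s - lcm_seq (omit j s))%MM] : R) *:
      Lbasis t (omit j s).

Definition Ldiff t (f : Lmod t.+1) : Lmod t :=
  \sum_(b : Lsymb t.+1) (f b : R) *: Ldiff_basis b.

Lemma nil_L_admissible : L_admissible [tuple of [::]].
Proof. by rewrite /L_admissible /=; apply/forallP => -[]. Qed.

(* The identification L^0 = R. *)
Definition Laug (f : Lmod 0) : R^o := f (Sub [tuple of [::]] nil_L_admissible : Lsymb 0).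

End Lyubeznik.

Definition lyubeznik_ideal (K : fieldType) (n : nat) (I : {mpoly K[n]} -> Prop)
    : Prop :=
  exists r : {set mingens I * mingens I},
    total_order r /\
    minimal_free_resolution_of_quotient (@irrelevant_ideal K n) I
      (@Laug K n (mingens I) r) (@Ldiff K n (mingens I) r).

Section MingensSpec.
Variables (K : fieldType) (n : nat).
Local Notation R := {mpoly K[n]}.
Implicit Types (I : R -> Prop) (S T : 'X_{1..n} -> Prop) (m : 'X_{1..n}).

Lemma ideal_gen_base (S : R -> Prop) p : S p -> ideal_gen S p.
Proof.
move=> Sp; exists [:: (1, p)]; split; first by move=> q; rewrite inE => /eqP->.
by rewrite big_seq1 scale1r.
Qed.

Lemma ideal_genD (S : R -> Prop) p q :
  ideal_gen S p -> ideal_gen S q -> ideal_gen S (p + q).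
Proof.
case=> s [Ss ->] [t [St ->]]; exists (s ++ t); split; last by rewrite big_cat.
by move=> u; rewrite mem_cat => /orP[/Ss|/St].
Qed.

Lemma ideal_genM (S : R -> Prop) a p : ideal_gen S p -> ideal_gen S (a * p).
Proof.
case=> s [Ss ->]; exists [seq (a * x.1, x.2) | x <- s]; split.
  by move=> u /mapP[v vs ->] /=; apply: Ss.
rewrite big_map (_ : a * _ = a *: (\sum_(p <- s) p.1 *: p.2 : R^o)) // scaler_sumr.
by apply: eq_bigr => x _; rewrite scalerA.
Qed.

Lemma ideal_gen_sub (S T : R -> Prop) :
  (forall p, S p -> ideal_gen T p) -> forall p, ideal_gen S p -> ideal_gen T p.
Proof.
move=> ST p [s [Ss ->]]; elim: s Ss => [|x s IH] Ss.
  by rewrite big_nil; exists [::]; split=> //; rewrite big_nil.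
rewrite big_cons; apply: ideal_genD.
  by apply: ideal_genM; apply/ST/Ss; rewrite inE eqxx.
by apply: IH => y ys; apply: Ss; rewrite inE ys orbT.
Qed.

Lemma monomials_of_sub S T :
  (forall m, S m -> exists2 m', T m' & (m' <= m)%MM) ->
  forall p, ideal_gen (@monomials_of K n S) p -> ideal_gen (@monomials_of K n T) p.
Proof.
move=> ST; apply: ideal_gen_sub => p [m /ST[m' Tm' le] ->].
rewrite -(submK le) mpolyXD; apply: ideal_genM; apply: ideal_gen_base.
by exists m'.
Qed.

Lemma monomials_of_mem S m :
  ideal_gen (@monomials_of K n S) 'X_[m] -> exists2 m', S m' & (m' <= m)%MM.
Proof.
case=> s [Ss e]; apply: NNPP => nS.
have : ('X_[m] : R)@_m = 0; last by rewrite mcoeffX eqxx => /eqP; rewrite oner_eq0.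
rewrite e raddf_sum /= big_seq big1 // => x /Ss[m' Sm' ->].
apply/memN_msupp_eq0/negP; rewrite /GRing.scale /= => mx.
have := msuppM_le mx; case/allpairsP => -[a b] /= [_].
rewrite msuppX inE => /eqP -> me; apply: nS; exists m' => //.
by rewrite me lem_addl.
Qed.

Lemma dickson S : exists B : seq 'X_{1..n},
  (forall m, m \in B -> S m) /\
  (forall m, S m -> exists2 b, b \in B & (b <= m)%MM).
Proof.
suff H k : forall S, exists B : seq 'X_{1..n},
    (forall m, m \in B -> S m) /\
    (forall m, S m -> exists2 b, b \in B & forall i : 'I_n, (i < k)%N -> (b i <= m i)%N).
  have [B [BS SB]] := H n S; exists B; split=> // m /SB[b bB le].
  by exists b => //; apply/mnm_lepP => i; apply: le.
elim: k => [|k IH] {}S.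
  have [[m Sm]|nS] := classic (exists m, S m); last first.
    by exists [::]; split=> // m Sm; case: nS; exists m.
  by exists [:: m]; split=> [m'|m' _]; [rewrite inE => /eqP->|exists m; rewrite ?inE].
have [kn|nk] := ltnP k n; last first.
  have [B [BS SB]] := IH S; exists B; split=> // m /SB[b bB le]; exists b => // i _.
  by apply: le; apply: leq_trans nk.
pose ik := Ordinal kn.
have [B [BS SB]] := IH S.
pose N := \max_(b <- B) b ik.
have [C [CS SC]] : exists C : seq 'X_{1..n},
    (forall m, m \in C -> S m) /\
    (forall m, S m -> (m ik < N)%N -> exists2 b, b \in C &
       forall i : 'I_n, (i < k.+1)%N -> (b i <= m i)%N).
  elim: N => [|N [C [CS SC]]]; first by exists [::].
  have [D [DS SD]] := IH (fun m => S m /\ m ik = N).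
  exists (C ++ D); split=> [m|m Sm].
    by rewrite mem_cat => /orP[/CS|/DS[]].
  rewrite ltnS leq_eqVlt => /orP[/eqP mN|mN].
    have [b bD le] := SD m (conj Sm mN); exists b; first by rewrite mem_cat bD orbT.
    move=> i; rewrite ltnS leq_eqVlt => /orP[/eqP ik_|/le//].
    have -> : i = ik by apply/val_inj.
    by have [_ ->] := DS b bD; rewrite mN.
  by have [b bC le] := SC m Sm mN; exists b => //; rewrite mem_cat bC.
exists (B ++ C); split=> [m|m Sm]; first by rewrite mem_cat => /orP[/BS|/CS].
have [mN|Nm] := ltnP (m ik) N.
  by have [b bC le] := SC m Sm mN; exists b => //; rewrite mem_cat bC orbT.
have [b bB le] := SB m Sm; exists b; first by rewrite mem_cat bB.
move=> i; rewrite ltnS leq_eqVlt => /orP[/eqP ik_|/le//].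
have -> : i = ik by apply/val_inj.
by apply: leq_trans Nm; apply: leq_bigmax_seq.
Qed.

Lemma minimal_generating_set_exists I :
  monomial_ideal I -> exists G, minimal_generating_set I G.
Proof.
case=> S SI; have [B [BS SB]] := dickson S.
have : exists G : {fset 'X_{1..n}}, generates (fun m => m \in G) I.
  exists (seq_fset tt B) => p; split.
    move=> /SI; apply: monomials_of_sub => m /SB[b bB le].
    by exists b => //; rewrite seq_fsetE.
  move=> h; apply/SI; move: h; apply: monomials_of_sub => m.
  by rewrite seq_fsetE => /BS Sm; exists m => //; apply: lepm_refl.
case=> G; move: {2}#|`G|.+1 (ltnSn #|`G|) => k.
elim: k G => // k IH G Gk GI.
have [[G' [G'G G'I]]|nG] := classic (exists G', G' `<` G /\ generates (fun m => m \in G') I).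
  by apply: (IH G') => //; apply: leq_trans (fproper_ltn_card G'G) _.
by exists G; split=> // G' G'G G'I; apply: nG; exists G'.
Qed.

Lemma minimal_generating_set_unique I G G' :
  minimal_generating_set I G -> minimal_generating_set I G' -> G = G'.
Proof.
suff H G1 G2 : minimal_generating_set I G1 -> minimal_generating_set I G2 ->
    G1 `<=` G2.
  by move=> h h'; apply/eqP; rewrite eqEfsubset !H.
case=> gG1 minG1 [gG2 _]; apply/fsubsetP => u uG1.
have mem (A B : {fset 'X_{1..n}}) v : generates (fun m => m \in A) I ->
    generates (fun m => m \in B) I -> v \in A ->
    exists2 w, w \in B & (w <= v)%MM.
  move=> gA gB vA; apply: monomials_of_mem; apply/gB/gA/ideal_gen_base.
  by exists v.
have [v vG2 vu] := mem _ _ _ gG1 gG2 uG1.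
have [w wG1 wv] := mem _ _ _ gG2 gG1 vG2.
have [wu|wu] := eqVneq w u.
  suff -> : u = v by [].
  apply/mnmP => i; apply/eqP; rewrite eqn_leq.
  by move/mnm_lepP: vu => ->; rewrite -wu; move/mnm_lepP: wv => ->.
case: (minG1 (G1 `\ u)); first by apply: fproperD1.
move=> p; split.
  move=> /gG1; apply: monomials_of_sub => m mG1.
  have [->|mu] := eqVneq m u; last by exists m; rewrite ?inE ?mu ?lepm_refl.
  by exists w; rewrite ?inE ?wu //; apply: lepm_trans vu.
move=> h; apply/gG1; move: h; apply: monomials_of_sub => m.
by rewrite !inE => /andP[_ mG1]; exists m => //; apply: lepm_refl.
Qed.

Lemma mingensP I : monomial_ideal I -> minimal_generating_set I (mingens I).
Proof.
by move=> /minimal_generating_set_exists hI; apply: epsilon_spec.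
Qed.

End MingensSpec.

(* Main.v *)
From HB Require Import structures.
Require Import Defs.
From mathcomp Require Import all_boot all_algebra.
From mathcomp Require Import finmap mpoly ssrcomplements.

(** Fix a total order on the minimal generators. Two facts carry the proof.

    The Lyubeznik complex is always a resolution. It is multigraded, and its
    part of multidegree [a] is the augmented chain complex, over the coefficient
    field, of the simplicial complex of those admissible symbols whose least
    common multiple divides [a] ([Ldiff_term]). If some generator divides [a],
    this simplicial complex is a cone whose apex is the least such generator
    ([admissible_cone]); otherwise it only has the empty face, which accounts
    for the quotient by the ideal. Joining with the apex, degree by degree, is
    therefore a contracting homotopy in positive dimension
    ([homotopy_identity]), and exactness follows ([Ldiff_exact]). In dimension
    zero the image of the differential is the ideal itself ([Laug_exact]).

    Hence the question is only about minimality. The coefficients of the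
    differential are, up to sign, the quotients of the least common multiple of
    a symbol by that of its faces, and the resolution is minimal if and only if
    none of them is 1. Such a coefficient is 1 exactly when the symbol is a cover
    of the entry left out. Since the minimal generators form an antichain, the
    admissible symbols are the increasing enumerations of the preserved sets
    ([admissible_preserved], [preserved_admissible]). So minimality says that no
    preserved set is a cover of one of its elements; passing to a minimal cover
    inside a cover, this is the vanishing of the obstruction for the given order
    ([minimal_ObsL_eq0]). The total obstruction, a minimum over all orders,
    vanishes if and only if the obstruction does for some order. *)

Set Implicit Arguments.
Unset Strict Implicit.
Unset Printing Implicit Defensive.

Import GRing.Theory.

Local Open Scope ring_scope.

(** * Least common multiples and omitted entries *)

Section LcmSeq.
Variables (n : nat) (G : {fset 'X_{1..n}}).
Implicit Types (s : seq G) (A : {set G}) (m : 'X_{1..n}).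

Lemma lcm_seq_nil : lcm_seq ([::] : seq G) = 0%MM.
Proof. by rewrite /lcm_seq big_nil. Qed.

Lemma lcm_seq_cons u s : lcm_seq (u :: s) = mlcm (val u) (lcm_seq s).
Proof. by rewrite /lcm_seq big_cons. Qed.

Lemma lem0 m : (0 <= m)%MM.
Proof. by apply/mnm_lepP => i; rewrite mnm0E. Qed.

Lemma lem_anti m m' : (m <= m')%MM -> (m' <= m)%MM -> m = m'.
Proof.
move=> /mnm_lepP h /mnm_lepP h'; apply/mnmP => i; apply/eqP.
by rewrite eqn_leq h h'.
Qed.

Lemma lcm_seq_leP s m :
  reflect (forall u, u \in s -> (val u <= m)%MM) (lcm_seq s <= m)%MM.
Proof.
apply: (iffP idP).
  elim: s => [|v s IH] // ; rewrite lcm_seq_cons lem_mlcm => /andP[vm sm] u.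
  by rewrite inE => /predU1P[->|/IH]; last apply.
elim: s => [|v s IH] h; first by rewrite lcm_seq_nil lem0.
rewrite lcm_seq_cons lem_mlcm h ?mem_head //=; apply: IH => u us.
by rewrite h // inE us orbT.
Qed.

Lemma mem_lcm_seq s u : u \in s -> (val u <= lcm_seq s)%MM.
Proof. exact/(lcm_seq_leP s _ (lepm_refl _)). Qed.

Lemma lcm_seq_sub s s' : {subset s <= s'} -> (lcm_seq s <= lcm_seq s')%MM.
Proof. by move=> ss'; apply/lcm_seq_leP => u /ss'/mem_lcm_seq. Qed.

Lemma lcm_set_seq A s : A =i s -> lcm_set A = lcm_seq s.
Proof.
move=> As; rewrite /lcm_set; have [e <- [_ eA] _] := big_enumP (mem A).
rewrite -/(lcm_seq e).
by apply: lem_anti; apply: lcm_seq_sub => u; rewrite eA -As.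
Qed.

Lemma lcm_setE A : lcm_set A = lcm_seq (enum A).
Proof. by apply: lcm_set_seq => u; rewrite mem_enum. Qed.

Lemma size_omit j s : (j < size s)%N -> size (omit j s) = (size s).-1.
Proof.
move=> js; rewrite size_cat size_take size_drop js.
by case: (size s) js => // k; rewrite ltnS subSS => jk; rewrite subnKC.
Qed.

Lemma omit0 u s : omit 0 (u :: s) = s.
Proof. by rewrite /omit /= drop0. Qed.

Lemma omitS j u s : omit j.+1 (u :: s) = u :: omit j s.
Proof. by []. Qed.

Lemma omit_subseq j s : subseq (omit j s) s.
Proof.
elim: s j => [|u s IH] [|j] //; first by rewrite omit0 subseq_cons.
by rewrite omitS /= eqxx.
Qed.

Lemma mem_omit j s : {subset omit j s <= s}.
Proof. exact/mem_subseq/omit_subseq. Qed.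

Lemma mem_omit_uniq j s u x0 : uniq s -> (j < size s)%N ->
  (u \in omit j s) = (u \in s) && (u != nth x0 s j).
Proof.
elim: s j => [|v s IH] [|j] //= /andP[vs us].
  rewrite omit0 inE => _; have [->|_] := eqVneq u v; first exact/negbTE.
  by rewrite andbT.
rewrite ltnS => js; rewrite omitS !inE IH //.
have [->|//] := eqVneq u v; symmetry; apply/negP => /eqP vj.
by move: vs; rewrite vj mem_nth.
Qed.

Lemma omit_inj s j k : uniq s -> (j < size s)%N -> (k < size s)%N ->
  omit j s = omit k s -> j = k.
Proof.
move=> us js ks e; apply/eqP; have x0 : G by case: s us js {ks e}.
rewrite -(nth_uniq x0 js ks us); apply: contraT => jk.
have := mem_omit_uniq (nth x0 s j) x0 us js.
by rewrite e (mem_omit_uniq _ x0) // eqxx mem_nth // jk.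
Qed.

End LcmSeq.

(** * Admissible symbols, preserved sets and cones *)

Section Admissible.
Variables (n : nat) (G : {fset 'X_{1..n}}) (r : {set G * G}).
Hypothesis hr : total_order r.
Implicit Types (s : seq G) (A D : {set G}) (m : 'X_{1..n}) (u v : G).

Lemma prec_irr u : prec r u u = false.
Proof. by case/and3P: hr => /forallP/(_ u)/negbTE. Qed.

Lemma prec_trans : transitive (prec r).
Proof.
move=> v u w uv vw; case/and3P: hr => _ /forallP/(_ u)/forallP/(_ v)/forallP/(_ w).
by rewrite uv vw /= => ->.
Qed.

Lemma prec_total u v : u != v -> prec r u v || prec r v u.
Proof. by move=> uv; case/and3P: hr => _ _ /forallP/(_ u)/forallP/(_ v)/implyP->. Qed.

(** L-admissibility of a symbol, by recursion on its head. The clause on the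
    head is waived for a one-element symbol because the definition quantifies
    over h < t only. *)
Fixpoint admissible s : bool :=
  if s is v :: s' then
    [&& all (prec r v) s',
        nilp s' || [forall w, prec r w v ==> ~~ (val w <= lcm_seq s)%MM]
      & admissible s']
  else true.

Lemma admissible_sorted s : admissible s -> sorted (prec r) s.
Proof.
elim: s => //= v s IH /and3P[vs _ /IH ss].
by rewrite (path_sortedE prec_trans) vs.
Qed.

Lemma admissible_uniq s : admissible s -> uniq s.
Proof.
by move=> /admissible_sorted; apply: (sorted_uniq prec_trans) => u; apply: prec_irr.
Qed.

(** The condition at h concerns the tail of the symbol that starts at h, so the
    one at h = 0 is the clause on the head and the others are those of the
    tail. *)
Lemma L_admissibleE t (s : t.-tuple G) : L_admissible r s = admissible s.
Proof.
transitivity (sorted (prec r) s && [forall h : 'I_(size s), forall v : G,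
    (h.+1 < size s)%N && prec r v (nth v s h) ==> ~~ (val v <= lcm_seq (drop h s))%MM]).
  rewrite /L_admissible size_tuple; congr andb; apply: eq_forallb => h.
  by apply: eq_forallb => v; rewrite (tnth_nth v).
case: s => s _ /=; elim: s => [|v s IH]; first by apply/forallP => -[].
rewrite /= (path_sortedE prec_trans) -IH; case: (all _ s) => //=.
rewrite andbCA; congr andb; apply/forallP/andP => [h|[h0 hS] [[|k] kP]].
- split; last first.
    apply/forallP => k; exact: (h (lift ord0 k)).
  case: s {IH} h => [|w s] h //=; apply/forallP => x.
  exact: (forallP (h ord0) x).
- apply/forallP => x; rewrite drop0 /=; case: s h0 {IH hS kP} => [|w s] //=.
  by move/forallP/(_ x).
- exact: (forallP hS (Ordinal (kP : (k < size s)%N))).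
Qed.

(** Admissible symbols are the faces of a simplicial complex: passing to a
    subsequence only lowers the least common multiples in the condition. In
    particular the faces in the differential are again basis elements. *)
Lemma admissible_subseq s s' : subseq s' s -> admissible s -> admissible s'.
Proof.
elim: s s' => [|v s IH] [|v' s'] //= ; case: eqVneq => [->|_] s's /and3P[vs hv ss].
  rewrite (IH _ s's ss) andbT; apply/andP; split.
    by apply/allP => x /(mem_subseq s's); apply/allP.
  case: s' s's => //= w s' s's; case/orP: hv => [/nilP s0|hv]; first by rewrite s0 in s's.
  apply/forallP => x; apply/implyP => /(implyP (forallP hv x)); apply: contraNN => le.
  apply: lepm_trans le _; apply: lcm_seq_sub => y.
  by rewrite !(in_cons v) => /predU1P[->|/(mem_subseq s's) ->]; rewrite ?eqxx ?orbT.
exact: (IH (v' :: s')).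
Qed.

Lemma admissible_omit j s : admissible s -> admissible (omit j s).
Proof. exact/admissible_subseq/omit_subseq. Qed.

(** The apex of the cone in multidegree [m]. *)
Definition least_divisor m u :=
  (val u <= m)%MM && [forall w, prec r w u ==> ~~ (val w <= m)%MM].

Lemma least_divisor_exists m : (exists u : G, (val u <= m)%MM) ->
  exists u, least_divisor m u.
Proof.
case=> u um.
have : exists k, [exists u : G, (val u <= m)%MM && (#|[set w | prec r w u]| == k)].
  by exists #|[set w | prec r w u]|; apply/existsP; exists u; rewrite um eqxx.
move=> /ex_minnP[k /existsP[v /andP[vm /eqP vk]] kmin]; exists v.
rewrite /least_divisor vm; apply/forallP => w; apply/implyP => wv; apply/negP => wm.
suff : (#|[set x | prec r x w]| < k)%N.
  by rewrite ltnNge kmin //; apply/existsP; exists w; rewrite wm eqxx.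
rewrite -vk; apply: proper_card; apply/properP; split.
  by apply/subsetP => x; rewrite !inE => xw; apply: prec_trans wv.
by exists w; rewrite !inE ?wv ?prec_irr.
Qed.

Lemma least_divisor_unique m u v :
  least_divisor m u -> least_divisor m v -> u = v.
Proof.
move=> /andP[um /forallP uP] /andP[vm /forallP vP]; apply/eqP; apply: contraT => uv.
by case/orP: (prec_total uv) => [/(implyP (vP u))|/(implyP (uP v))]; rewrite ?um ?vm.
Qed.

Lemma least_divisor_le m u v : least_divisor m u -> (val v <= m)%MM -> v != u ->
  prec r u v.
Proof.
move=> /andP[um /forallP uP] vm vu.
by case/orP: (prec_total vu) => // /(implyP (uP v)); rewrite vm.
Qed.

(** In multidegree [m] the complex of admissible symbols is a cone with apex the
    least generator dividing [m]: any generator that divides the least common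
    multiple of the longer symbol divides [m], hence does not precede [q]. *)
Lemma admissible_cone m q s : least_divisor m q -> (lcm_seq s <= m)%MM ->
  q \notin s -> admissible s -> admissible (q :: s).
Proof.
move=> qm sm qs /= ->; rewrite andbT; apply/andP; split.
  apply/allP => v vs; apply: (least_divisor_le qm); first exact: (lcm_seq_leP _ _ sm).
  by apply: contraNneq qs => <-.
apply/orP; right; case/andP: qm => qm /forallP qP.
apply/forallP => w; apply/implyP => /(implyP (qP w)); apply: contraNN => /lepm_trans.
by apply; rewrite lcm_seq_cons lem_mlcm qm.
Qed.

Lemma admissible_head m q s : least_divisor m q -> (lcm_seq s <= m)%MM ->
  admissible s -> q \in s -> exists s', s = q :: s'.
Proof.
case: s => // v s qm sm /= /and3P[vs _ _]; rewrite inE => /predU1P[->|qs]; first by exists s.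
have := implyP (forallP (andP qm).2 v) (allP vs q qs).
by rewrite (lcm_seq_leP _ _ sm) ?mem_head.
Qed.

Hypothesis antichain : forall u v : G, (val u <= val v)%MM -> u = v.

(** A broken subset with least element [d] would make its witness violate the
    admissibility condition at [d]. When [d] is the last entry there is no such
    condition; the subset is then the singleton of [d], and it is not broken
    because the generators form an antichain. *)
Lemma admissible_preserved s A : A =i s -> admissible s -> preserved r A.
Proof.
move=> As ss; apply/forallP => D; apply/implyP => DA; apply/negP.
have {DA As A}: {subset D <= s} by move=> x /(subsetP DA); rewrite As.
elim: s ss D => [|v s IH] /=; first by move=> _ D D0 /existsP[d /andP[/andP[/D0]]].
case/and3P=> vs hv ss D Ds; have [vD|vD] := boolP (v \in D); last first.
  apply: IH => // x xD; have := Ds x xD; rewrite inE.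
  by have [xv|] := eqVneq x v; first by rewrite -xv xD in vD.
case/existsP=> d /andP[/andP[dD /forall_inP dmin] /existsP[w /andP[wD wd]]].
have {dmin} dv : d = v.
  have := Ds d dD; rewrite inE => /predU1P[//|/(allP vs) vd].
  have := dmin v vD; case/predU1P => // dv.
  by have := prec_trans vd dv; rewrite prec_irr.
rewrite {d}dv in wd dD; case/orP: hv => [/nilP s0|/forallP/(_ w)].
  rewrite s0 in Ds; move: wD; rewrite (@lcm_set_seq _ _ D [:: v]); last first.
    by move=> x; rewrite inE; apply/idP/eqP => [/Ds|->//]; rewrite inE => /eqP.
  rewrite lcm_seq_cons lcm_seq_nil mlcm0 => /antichain wv.
  by rewrite wv prec_irr in wd.
rewrite wd /= => /negP; apply; apply: lepm_trans wD _.
by rewrite lcm_setE; apply: lcm_seq_sub => x; rewrite mem_enum => /Ds.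
Qed.

(** Each entry is the least element of the tail that it starts, and this tail
    is not broken. *)
Lemma preserved_admissible s A : A =i s -> preserved r A -> sorted (prec r) s ->
  admissible s.
Proof.
move=> As /forallP pA; have {pA} pA (D : {set G}) : {subset D <= s} -> ~~ broken r D.
  by move=> Ds; apply: (implyP (pA D)); apply/subsetP => x /Ds; rewrite As.
elim: s pA {A As} => //= v s IH pA; rewrite (path_sortedE prec_trans) => /andP[vs ss].
rewrite vs IH ?andbT //=; last by move=> D Ds; apply: pA => x /Ds; rewrite inE orbC => ->.
apply/orP; right; apply/forallP => w; apply/implyP => wv; apply/negP => wle.
have /existsP : ~~ broken r [set x in v :: s].
  by apply: pA => x; rewrite inE.
apply; exists v; apply/andP; split.
  rewrite /is_min inE mem_head; apply/forall_inP => e; rewrite inE in_cons.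
  by case/predU1P=> [->|/(allP vs) ->]; rewrite ?eqxx ?orbT.
apply/existsP; exists w; rewrite wv andbT (@lcm_set_seq _ _ _ (v :: s)) //.
by move=> x; rewrite inE.
Qed.

Lemma sorted_enum A : exists2 s, A =i s & sorted (prec r) s.
Proof.
pose le : rel G := fun u v => (u == v) || prec r u v.
have le_tot : total le.
  by move=> u v; rewrite /le; case: eqVneq => //= /prec_total.
exists (sort le (enum A)); first by move=> u; rewrite mem_sort mem_enum.
have: uniq (sort le (enum A)) by rewrite sort_uniq enum_uniq.
have: sorted le (sort le (enum A)) by apply: sort_sorted.
elim: (sort le _) => // u [|v s] //= IH /andP[uv vs] /andP[us uniq_s].
rewrite IH // andbT; case/predU1P: uv => // uv.
by rewrite uv mem_head in us.
Qed.

End Admissible.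

(** * The complex *)

(** The simplicial identity behind the square-zero property of the
    differential, for an arbitrary function of the faces. By induction on the
    sequence: the faces that drop the head cancel in pairs, and the remaining
    ones are the double faces of the tail with the head put back. *)
Lemma omit_omit_cancel (n : nat) (G : {fset 'X_{1..n}}) (R : nzRingType)
    (V : lmodType R) (F : seq G -> V) (s : seq G) :
  \sum_(j < size s) (-1) ^+ j *:
    \sum_(i < (size s).-1) (-1) ^+ i *: F (omit i (omit j s)) = 0.
Proof.
elim: s F => [|v s IH] F; first by rewrite big_ord0.
rewrite [size _]/= big_ord_recl /= omit0 expr0 scale1r.
case s0: (size s) => [|k]; first by rewrite !big_ord0 addr0.
have := IH (fun s' => F (v :: s')); rewrite s0 /= => IHF.
under [X in _ + X]eq_bigr => j _.
  rewrite big_ord_recl /= expr0 scale1r omit0 exprS mulN1r scaleNr scalerDr opprD.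
  under eq_bigr => i _ do rewrite exprS mulN1r scaleNr.
  rewrite sumrN scalerN opprK.
  over.
by rewrite big_split /= sumrN addrA subrr add0r IHF.
Qed.

(** * Additive maps prescribed on monomials *)

Section CoefSum.
Variables (K : fieldType) (n : nat) (V : zmodType).
Variable F : 'X_{1..n} -> {additive K -> V}.
Implicit Types p q : {mpoly K[n]}.

(** The additive map that sends the monomial [m] with coefficient [c] to
    [F m c]. The homotopy depends on the multidegree, so it is not linear over
    the polynomial ring; this is how it is extended from monomials. *)
Definition coef_sum p : V := \sum_(m <- msupp p) F m p@_m.

(** Additivity is not visible on the supports, which vary with the polynomial;
    summing over all monomials of bounded degree removes this dependency. *)
Lemma coef_sum_wide k p : (msize p <= k)%N ->
  coef_sum p = \sum_(m : 'X_{1..n < k}) F m p@_m.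
Proof.
move=> pk; rewrite /coef_sum (big_mksub ('X_{1..n < k} : subFinType _)) //=; first last.
- by move=> m /msize_mdeg_lt /leq_trans; apply.
- exact: msupp_uniq.
by rewrite big_rmcond //= => i /memN_msupp_eq0 ->; rewrite raddf0.
Qed.

Lemma coef_sum_is_zmod_morphism : zmod_morphism coef_sum.
Proof.
move=> p q; pose k := maxn (msize (p - q)) (maxn (msize p) (msize q)).
rewrite !(@coef_sum_wide k) ?leq_max ?leqnn ?orbT // -sumrB.
by apply: eq_bigr => m _; rewrite mcoeffB raddfB.
Qed.

HB.instance Definition _ :=
  GRing.isZmodMorphism.Build {mpoly K[n]} V coef_sum coef_sum_is_zmod_morphism.

Lemma coef_sumZX c m : coef_sum (c *: 'X_[m]) = F m c.
Proof.
have [->|c0] := eqVneq c 0; first by rewrite scale0r !raddf0.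
by rewrite /coef_sum msuppMCX // big_seq1 mcoeffZ mcoeffX eqxx mulr1.
Qed.

End CoefSum.

(** * Homogeneous chains and the contracting homotopy *)

Section Chains.
Variables (K : fieldType) (n : nat) (G : {fset 'X_{1..n}}) (r : {set G * G}).
Hypothesis hr : total_order r.
Local Notation R := {mpoly K[n]}.
Local Notation L := (Lmod K r).
Implicit Types (s : seq G) (a m : 'X_{1..n}) (c : K).

Lemma admissible_symb t s : size s = t -> admissible r s ->
  exists b : Lsymb r t, tval (val b) = s.
Proof.
move=> st ss; have ts : size s == t by apply/eqP.
have ls : L_admissible r (Tuple ts) by rewrite (L_admissibleE hr).
by exists (Sub (Tuple ts) ls); rewrite SubK.
Qed.

Lemma symb_admissible t (b : Lsymb r t) : admissible r (tval (val b)).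
Proof. by rewrite -(L_admissibleE hr); apply: valP. Qed.

Lemma symb_eq t (b b' : Lsymb r t) :
  (tval (val b) == tval (val b')) = (b == b').
Proof. by []. Qed.

Lemma scale_LbasisE t (p : R) (b b' : Lsymb r t) :
  (p *: Lbasis K r t (tval (val b))) b' = (if b' == b then p else 0).
Proof.
by rewrite !ffunE symb_eq; case: eqP => _; rewrite ?scaler0 //; apply: mulr1.
Qed.

Lemma Lmod_basis t (f : L t) : f = \sum_b (f b : R) *: Lbasis K r t (tval (val b)).
Proof.
apply/ffunP => b; rewrite sum_ffunE (bigD1 b) //= big1 => [|b' b'b].
  by rewrite addr0 scale_LbasisE eqxx.
by rewrite scale_LbasisE eq_sym (negbTE b'b).
Qed.

Lemma Ldiff_is_linear t : linear (@Ldiff K n G r t).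
Proof.
move=> k f g; rewrite /Ldiff scaler_sumr -big_split /=; apply: eq_bigr => b _.
by rewrite !ffunE scalerDl scalerA.
Qed.

HB.instance Definition _ t := GRing.isLinear.Build R (L t.+1) (L t) *:%R
  (@Ldiff K n G r t) (@Ldiff_is_linear t).

Lemma Ldiff_Lbasis t (b : Lsymb r t.+1) :
  Ldiff (Lbasis K r t.+1 (tval (val b))) = Ldiff_basis K b.
Proof.
rewrite /Ldiff (bigD1 b) //= big1 => [|b' b'b].
  by rewrite addr0 !ffunE eqxx scale1r.
by rewrite !ffunE symb_eq (negbTE b'b) scale0r.
Qed.

(** The generators, over the coefficient field, of the part of multidegree [a]
    of the complex: when the least common multiple of [s] divides [a], the basis
    element of [s] times the monomial that brings it to degree [a]. *)
Definition homog_term t a s c : L t :=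
  (c *: 'X_[(a - lcm_seq s)%MM] : R) *: Lbasis K r t s.

Lemma homog_term_is_zmod_morphism t a s : zmod_morphism (homog_term t a s).
Proof. by move=> c d; rewrite /homog_term scalerBl scalerBl. Qed.

HB.instance Definition _ t a s := GRing.isZmodMorphism.Build K (L t)
  (homog_term t a s) (homog_term_is_zmod_morphism t a s).

Lemma Lmod_terms t (f : L t) :
  f = \sum_(b : Lsymb r t) \sum_(m <- msupp (f b))
        homog_term t (m + lcm_seq (tval (val b)))%MM (tval (val b)) (f b)@_m.
Proof.
rewrite {1}(Lmod_basis f); apply: eq_bigr => b _.
by rewrite {1}(mpolyE (f b)) scaler_suml; apply: eq_bigr => m _; rewrite /homog_term addmK.
Qed.

(** The complex is the direct sum of its multigraded parts, so identities
    between additive maps need only be checked on homogeneous terms. *)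
Lemma additive_eq_terms t (V : zmodType) (phi psi : {additive L t -> V}) :
  (forall a s c, size s = t -> admissible r s -> (lcm_seq s <= a)%MM ->
     phi (homog_term t a s c) = psi (homog_term t a s c)) ->
  phi =1 psi.
Proof.
move=> eq_t f; rewrite (Lmod_terms f) !raddf_sum; apply: eq_bigr => b _.
rewrite !raddf_sum; apply: eq_bigr => m _; apply: eq_t.
- by rewrite size_tuple.
- exact: symb_admissible.
- exact: lem_addl.
Qed.

(** In a fixed multidegree the monomial coefficients disappear and the
    differential becomes the simplicial boundary. *)
Lemma Ldiff_term t a s c : size s = t.+1 -> admissible r s ->
  (lcm_seq s <= a)%MM ->
  Ldiff (homog_term t.+1 a s c) =
    \sum_(j < t.+1) (-1) ^+ j *: homog_term t a (omit j s) c.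
Proof.
move=> st ss sa; have [b bs] := admissible_symb st ss.
rewrite /homog_term linearZ /= -bs Ldiff_Lbasis /Ldiff_basis scaler_sumr.
apply: eq_bigr => j _; rewrite !scalerA bs; congr (_ *: _).
rewrite -scalerAl mulrCA -scalerAr -mpolyXD; congr (_ *: (_ * 'X_[_])).
have os : (lcm_seq (omit j s) <= lcm_seq s)%MM by apply: lcm_seq_sub; apply: mem_omit.
apply: (@addIm _ (lcm_seq (omit j s))).
by rewrite -addmA !submK // (lepm_trans os).
Qed.

Lemma Ldiff_Ldiff t (f : L t.+2) : Ldiff (Ldiff f) = 0.
Proof.
apply: (@additive_eq_terms _ _ (@Ldiff K n G r t \o @Ldiff K n G r t.+1) \0) f.
move=> a s c st ss sa /=; rewrite (Ldiff_term _ st ss sa) linear_sum /=.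
rewrite -[RHS](omit_omit_cancel (fun s' => homog_term t a s' c) s) st.
apply: eq_bigr => j _; rewrite linearZ /= Ldiff_term //.
- by rewrite size_omit st.
- exact: admissible_omit.
- by apply: lepm_trans sa; apply: lcm_seq_sub; apply: mem_omit.
Qed.

(** Joining a simplex of multidegree [a] to the apex, and killing the simplices
    that contain the apex already. *)
Definition cone t a s c : L t.+1 :=
  if [pick q | least_divisor r a q] is Some q then
    if q \in s then 0 else homog_term t.+1 a (q :: s) c
  else 0.

Lemma coneE t a s c q : least_divisor r a q ->
  cone t a s c = if q \in s then 0 else homog_term t.+1 a (q :: s) c.
Proof.
rewrite /cone => qa; case: pickP => [q' q'a|/(_ q)]; last by rewrite qa.
by rewrite (least_divisor_unique hr q'a qa).
Qed.

Lemma cone_is_zmod_morphism t a s : zmod_morphism (cone t a s).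
Proof.
move=> c d; rewrite /cone; case: pickP => [q _|_]; last by rewrite subr0.
by case: ifP => _; rewrite ?subr0 ?raddfB.
Qed.

HB.instance Definition _ t a s := GRing.isZmodMorphism.Build K (L t.+1)
  (cone t a s) (cone_is_zmod_morphism t a s).

Definition homotopy t (f : L t) : L t.+1 :=
  \sum_(b : Lsymb r t)
    coef_sum (fun m => cone t (m + lcm_seq (tval (val b)))%MM (tval (val b))) (f b).

Lemma homotopy_is_zmod_morphism t : zmod_morphism (@homotopy t).
Proof.
move=> f g; rewrite /homotopy -sumrB; apply: eq_bigr => b _.
by rewrite !ffunE raddfB.
Qed.

HB.instance Definition _ t := GRing.isZmodMorphism.Build (L t) (L t.+1)
  (@homotopy t) (@homotopy_is_zmod_morphism t).

Lemma homotopy_term t a s c : size s = t -> admissible r s ->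
  (lcm_seq s <= a)%MM -> homotopy (homog_term t a s c) = cone t a s c.
Proof.
move=> st ss sa; have [b bs] := admissible_symb st ss.
rewrite /homotopy /homog_term -bs (bigD1 b) //= big1 => [|b' b'b].
  rewrite addr0 scale_LbasisE eqxx bs coef_sumZX /=.
  by rewrite submK.
by rewrite scale_LbasisE (negbTE b'b) raddf0.
Qed.

(** The usual contraction of a cone. A simplex without the apex [q] is the
    zeroth face of its join with [q], and the other faces of the join are the
    joins of its own faces. For a simplex that contains [q], only the face
    opposite to [q] survives the homotopy. In positive dimension a symbol is
    nonempty, so that some generator divides the multidegree and there is an
    apex. *)
Lemma homotopy_identity t (f : L t.+1) :
  Ldiff (homotopy f) + homotopy (Ldiff f) = f.
Proof.
apply: (@additive_eq_terms _ _
  ((@Ldiff K n G r t.+1 \o @homotopy t.+1) \+ (@homotopy t \o @Ldiff K n G r t)) idfun) f.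
move=> a s c st ss sa /=; rewrite homotopy_term //.
have osa j : (lcm_seq (omit j s) <= a)%MM.
  by apply: lepm_trans sa; apply: lcm_seq_sub; apply: mem_omit.
have [q qa] : exists q, least_divisor r a q.
  apply: least_divisor_exists => //; case: s st sa {ss osa} => // v s _ sa.
  by exists v; apply: (lcm_seq_leP _ _ sa); rewrite mem_head.
(* Only the additivity of the homotopy is available, so the signs have to be
   resolved before they commute with it. *)
have -> : homotopy (Ldiff (homog_term t.+1 a s c)) =
    \sum_(j < t.+1) (-1) ^+ j *:
      (if q \in omit j s then 0 else homog_term t.+1 a (q :: omit j s) c).
  rewrite Ldiff_term // raddf_sum; apply: eq_bigr => j _.
  rewrite -signr_odd !scaler_sign.
  have <- : homotopy (homog_term t a (omit j s) c) =
     if q \in omit j s then 0 else homog_term t.+1 a (q :: omit j s) c.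
    rewrite homotopy_term ?(coneE _ _ _ qa) ?size_omit ?st //.
    exact: admissible_omit.
  by case: odd; rewrite ?raddfN.
rewrite (coneE _ _ _ qa); have [qs|qs] := boolP (q \in s).
  have [s' ss'] := admissible_head qa sa ss qs.
  move: (admissible_uniq hr ss); rewrite ss' => /= /andP[qs' _].
  rewrite raddf0 add0r big_ord_recl big1 => [|j _].
    by rewrite omit0 (negbTE qs') expr0 scale1r addr0.
  by rewrite omitS mem_head scaler0.
have [sqs aqs] := (congr1 succn st : size (q :: s) = t.+2,
  admissible_cone hr qa sa qs ss).
rewrite Ldiff_term //; last by rewrite lcm_seq_cons lem_mlcm sa (andP qa).1.
rewrite big_ord_recl omit0 expr0 scale1r -addrA -big_split /= big1 ?addr0 // => j _.
rewrite omitS ifN ?exprS ?mulN1r ?scaleNr ?addNr //.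
by apply: contraNN qs; apply: mem_omit.
Qed.

Lemma Ldiff_exact t (f : L t.+1) :
  Ldiff f = 0 <-> exists g, f = Ldiff g.
Proof.
split=> [df|[g ->]]; last exact: Ldiff_Ldiff.
by exists (homotopy f); rewrite -{1}(homotopy_identity f) df raddf0 addr0.
Qed.

End Chains.

(** * Minimality *)

Section Span.
Variables (R : comNzRingType) (V : lmodType R) (S : V -> Prop).

Lemma span_ind (P : V -> Prop) :
  P 0 -> (forall x y, P x -> P y -> P (x + y)) ->
  (forall (a : R) x, S x -> P (a *: x)) -> forall x, Defs.span S x -> P x.
Proof.
move=> P0 PD PS x [s [Ss ->]]; elim: s Ss => [|p s IH] Ss; first by rewrite big_nil.
rewrite big_cons; apply: PD; first by apply: PS; apply: Ss; rewrite mem_head.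
by apply: IH => q qs; apply: Ss; rewrite inE qs orbT.
Qed.

Lemma span_base x : S x -> Defs.span S x.
Proof.
move=> Sx; exists [:: (1, x)]; split; first by move=> p; rewrite inE => /eqP ->.
by rewrite big_seq1 scale1r.
Qed.

Lemma spanZ (a : R) x : Defs.span S x -> Defs.span S (a *: x).
Proof.
case=> s [Ss ->]; exists [seq (a * p.1, p.2) | p <- s]; split.
  by move=> p /mapP[q qs ->] /=; apply: Ss.
by rewrite big_map scaler_sumr; apply: eq_bigr => p _; rewrite scalerA.
Qed.

Lemma span_sum (T : Type) (s : seq T) (F : T -> V) :
  (forall i, Defs.span S (F i)) -> Defs.span S (\sum_(i <- s) F i).
Proof.
move=> SF; elim/big_rec: _ => [|i x _ [l [Sl ->]]].
  by exists [::]; rewrite big_nil; split.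
have [k [Sk ->]] := SF i; exists (k ++ l); split; last by rewrite big_cat.
by move=> p; rewrite mem_cat => /orP[/Sk|/Sl].
Qed.

End Span.

Section Irrelevant.
Variables (K : fieldType) (n : nat).
Local Notation R := {mpoly K[n]}.
Local Notation mm := (@irrelevant_ideal K n).

Lemma irrelevant_mcoeff0 (p : R) : mm p -> p@_0 = 0.
Proof.
move: p; apply: (@span_ind R R^o _ (fun p : R => p@_0 = 0)) => [|p q p0 q0|a _ [i ->]].
- exact: mcoeff0.
- by rewrite mcoeffD p0 q0 addr0.
- change ((a * 'X_i)@_0 = 0); rewrite rmorphM /= mcoeffX.
  by rewrite mnm1_eq0 mulr0.
Qed.

Lemma irrelevant_mpolyX (m : 'X_{1..n}) : m != 0%MM -> mm 'X_[m].
Proof.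
move=> m0; have [i mi] : exists i, m i != 0%N.
  apply/existsP; apply: contraNT m0; rewrite negb_exists => /forallP m0.
  by apply/eqP/mnmP => i; rewrite mnm0E; apply/eqP; rewrite -[_ == _]negbK.
have -> : m = ((m - U_(i)) + U_(i))%MM by rewrite submK // lep1mP.
by rewrite mpolyXD; apply: ideal_genM; apply: ideal_gen_base; exists i.
Qed.

Lemma irrelevant_smul_mcoeff0 (T : finType) (f : {ffun T -> R^o}) i :
  ideal_smul mm f -> (f i : R)@_0 = 0.
Proof.
move: f; apply: (@span_ind R {ffun T -> R^o} _ (fun f => (f i : R)@_0 = 0))
  => [|f g f0 g0|p _ [a [g [ma ->]]]].
- by rewrite ffunE mcoeff0.
- by rewrite ffunE mcoeffD f0 g0 addr0.
- rewrite scalerA ffunE; change ((p * a * g i)@_0 = 0); rewrite !rmorphM /=.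
  by rewrite (irrelevant_mcoeff0 ma) mulr0 mul0r.
Qed.

End Irrelevant.

Section Minimality.
Variables (K : fieldType) (n : nat) (G : {fset 'X_{1..n}}) (r : {set G * G}).
Hypothesis hr : total_order r.
Hypothesis antichain : forall u v : G, (val u <= val v)%MM -> u = v.
Local Notation R := {mpoly K[n]}.
Local Notation mm := (@irrelevant_ideal K n).

(** A cover of [u] contains a minimal one, which is preserved when the given
    cover is. *)
Lemma ObsL_eq0 :
  ObsL r = 0%N <-> forall A u, Defs.cover A u -> ~~ preserved r A.
Proof.
split=> [O0 A u Au|noA].
  apply/negP => pA.
  have [C /minsetP[Cu Cmin] CA] := minset_exists (P := (fun C => Defs.cover C u)) Au.
  have : CE C && preserved r C.
    apply/andP; split.
      apply/existsP; exists u; rewrite /Eminimal_cover Cu.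
      apply/forallP => C'; apply/implyP => C'C; apply/negP => C'u.
      have C'E : C' = C by apply: Cmin; rewrite ?proper_sub.
      by rewrite C'E properxx in C'C.
    apply/forallP => D; apply/implyP => DC; apply: (implyP (forallP pA D)).
    exact: subset_trans CA.
  move=> CP; have := O0; rewrite /ObsL (bigD1 C) //= => /eqP.
  rewrite -leqn0 geq_max leqn0 => /andP[/eqP/cards0_eq C0 _].
  by case/andP: Cu; rewrite C0 inE.
apply: big1 => A /andP[/existsP[u /andP[Au _]]].
by rewrite (negbTE (noA _ _ Au)).
Qed.

Lemma cover_omit (A : {set G}) s u : uniq s -> A =i s -> u \in s ->
  Defs.cover A u = (lcm_seq s <= lcm_seq (omit (index u s) s))%MM.
Proof.
move=> us As uins; rewrite /Defs.cover As uins /=.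
have ius : (index u s < size s)%N by rewrite index_mem.
rewrite (@lcm_set_seq _ _ _ (omit (index u s) s)); last first.
  by move=> x; rewrite !inE (mem_omit_uniq x u us ius) nth_index // As andbC.
apply/idP/lcm_seq_leP => [le x xs|]; last by apply.
have [-> //|xu] := eqVneq x u.
by apply: mem_lcm_seq; rewrite (mem_omit_uniq x u us ius) nth_index ?xs.
Qed.

(** The entries of a symbol are distinct, so that each face arises from a single
    index and no cancellation occurs between the summands. *)
Lemma Ldiff_basis_coef t (b : Lsymb r t.+1) (b' : Lsymb r t) (j : 'I_t.+1) :
  tval (val b') = omit j (tval (val b)) ->
  Ldiff_basis K b b' = (-1) ^+ j *
    'X_[(lcm_seq (tval (val b)) - lcm_seq (omit j (tval (val b))))%MM] :> R.
Proof.
move=> bj; rewrite sum_ffunE (bigD1 j) //= big1 => [|k kj].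
  by rewrite -bj scale_LbasisE eqxx addr0.
rewrite !ffunE bj eq_sym; case: eqP => [e|_]; last by rewrite scaler0.
have ub : uniq (tval (val b)) by apply: (admissible_uniq hr (symb_admissible hr b)).
case/eqP: kj; apply: val_inj; apply: (omit_inj ub) e; rewrite size_tuple; apply: ltn_ord.
Qed.

(** The coefficient of a face in the differential is, up to sign, the monomial
    quotient of the two least common multiples. It escapes the irrelevant ideal
    exactly when it is 1, that is, when the omitted generator divides the least
    common multiple of the others, and then the symbol is a preserved cover. *)
Lemma minimal_ObsL_eq0 :
  (forall t (x : Lmod K r t.+1), ideal_smul mm (Ldiff x)) <-> ObsL r = 0%N.
Proof.
rewrite ObsL_eq0; split=> [dmm A u Au|noA t x].
  apply/negP => pA; have [s As ss] := sorted_enum hr A.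
  have {}ss := preserved_admissible hr As pA ss; have us := admissible_uniq hr ss.
  have uins : u \in s by rewrite -As; case/andP: Au.
  have ius : (index u s < size s)%N by rewrite index_mem.
  rewrite (cover_omit us As uins) in Au.
  have [b bs] := admissible_symb hr (esym (ltn_predK ius)) ss.
  have [|b' b's] := admissible_symb (t := (size s).-1) hr _ (admissible_omit (index u s) ss).
    by rewrite size_omit.
  have jP : (index u s < (size s).-1.+1)%N by rewrite (ltn_predK ius).
  have := irrelevant_smul_mcoeff0 b' (dmm _ (Lbasis K r _ (tval (val b)))).
  rewrite Ldiff_Lbasis (@Ldiff_basis_coef _ b b' (Ordinal jP)) ?bs // => /eqP.
  have -> : (lcm_seq s - lcm_seq (omit (index u s) s))%MM = 0%MM.
    by apply/mnmP => i; rewrite mnmBE mnm0E; apply/eqP/(mnm_lepP Au).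
  by rewrite mpolyX0 mulr1 rmorphXn rmorphN1 signr_eq0.
apply: span_sum => b; apply: spanZ; apply: span_sum => j.
set s := tval (val b); have sz : size s = t.+1 by rewrite size_tuple.
apply: span_base; do 2!eexists; split; last by [].
apply: ideal_genM; apply: irrelevant_mpolyX; apply/eqP => e0.
have ss : admissible r s := symb_admissible hr b.
have us := admissible_uniq hr ss.
pose u := tnth (val b) j; have uj : u = nth u s j by apply: tnth_nth.
have uins : u \in s by apply: mem_tnth.
have As : [set x in s] =i s by move=> v; rewrite inE.
apply: (negP (noA [set x in s] u _)); last exact: (admissible_preserved hr antichain As).
rewrite (cover_omit us As uins) uj index_uniq ?sz //.
by apply/mnm_lepP => i; rewrite -subn_eq0 -mnmBE e0 mnm0E.
Qed.

End Minimality.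

(** * The augmentation and the resolution *)

Section Resolution.
Variables (K : fieldType) (n : nat) (I : {mpoly K[n]} -> Prop).
Variables (G : {fset 'X_{1..n}}) (r : {set G * G}).
Hypothesis hr : total_order r.
Hypothesis genG : generates (fun m => m \in G) I.
Local Notation R := {mpoly K[n]}.

Lemma Laug_is_linear : linear (@Laug K n G r).
Proof. by move=> a f g; rewrite /Laug !ffunE. Qed.

HB.instance Definition _ := GRing.isLinear.Build R (Lmod K r 0) R^o *:%R
  (@Laug K n G r) Laug_is_linear.

Let nil_symb : Lsymb r 0 := Sub [tuple of [::]] (nil_L_admissible r).

Lemma LaugZ_Lbasis (p : R) : Laug (p *: Lbasis K r 0 [::]) = p.
Proof. by have := scale_LbasisE p nil_symb nil_symb; rewrite eqxx. Qed.

Lemma Lmod0_Laug (f : Lmod K r 0) : f = (Laug f : R) *: Lbasis K r 0 [::].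
Proof.
apply/ffunP => b; have -> : b = nil_symb by apply: val_inj; rewrite [RHS]tuple0 [LHS]tuple0.
by have := scale_LbasisE (Laug f) nil_symb nil_symb; rewrite eqxx => ->.
Qed.

Lemma Ldiff_basis1 (b : Lsymb r 1) (u : G) : tval (val b) = [:: u] ->
  Ldiff_basis K b = ('X_[val u] : R) *: Lbasis K r 0 [::].
Proof.
move=> bu; rewrite /Ldiff_basis big_ord_recl big_ord0 addr0 bu omit0 /= mul1r.
rewrite lcm_seq_cons lcm_seq_nil mlcm0; congr ('X_[_] *: _).
by apply/mnmP => i; rewrite mnmBE mnm0E subn0.
Qed.

(** The image of the first differential is the ideal generated by [G]: a
    one-element symbol is always admissible, and it maps to its generator. *)
Lemma Laug_exact (f : Lmod K r 0) : I (Laug f) <-> exists g, f = Ldiff g.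
Proof.
split=> [/genG|[g ->]]; last first.
  apply/genG; rewrite /Ldiff linear_sum; apply: span_sum => b.
  rewrite linearZ /=; apply: spanZ.
  have [u bu] : exists u, tval (val b) = [:: u].
    by case: (val b) => -[|u []] //= _; exists u.
  rewrite (Ldiff_basis1 bu) LaugZ_Lbasis; apply: span_base.
  by exists (val u) => //; apply: valP.
rewrite {2}(Lmod0_Laug f); move: (Laug f).
apply: (@span_ind R R^o _ (fun p : R => exists g, p *: Lbasis K r 0 [::] = Ldiff g))
  => [|x y [g gx] [h hy]|a _ [m mG ->]].
- by exists 0; rewrite scale0r linear0.
- by exists (g + h); rewrite scalerDl gx hy linearD.
have [b bu] := @admissible_symb _ _ r hr 1 [:: [` mG]%fset] erefl isT.
exists (a *: Lbasis K r 1 (tval (val b))).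
by rewrite linearZ /= Ldiff_Lbasis (Ldiff_basis1 bu) scalerA.
Qed.

Lemma Lyubeznik_resolution :
  free_resolution_of_quotient I (@Laug K n G r) (@Ldiff K n G r).
Proof.
split.
- by split=> [|t]; [apply: Laug_is_linear|apply: Ldiff_is_linear].
- move=> a; exists (a *: Lbasis K r 0 [::]); rewrite LaugZ_Lbasis subrr.
  by apply/genG; exists [::]; rewrite big_nil.
- exact: Laug_exact.
- by move=> t f; apply: Ldiff_exact.
Qed.

End Resolution.

(** * The characterization of Lyubeznik ideals *)

(** A generator with a proper divisor among the generators is redundant. *)
Lemma mingens_antichain (K : fieldType) (n : nat) (I : {mpoly K[n]} -> Prop)
    (G : {fset 'X_{1..n}}) : minimal_generating_set I G ->
  forall u v : G, (val u <= val v)%MM -> u = v.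
Proof.
case=> genG minG u v uv; apply/eqP; apply: contraT => neq_uv.
case: (minG (G `\ val v)%fset); first by apply: fproperD1; apply: valP.
move=> p; apply: iff_trans (genG p) _; split; apply: monomials_of_sub => m.
  move=> mG; have [->|mv] := eqVneq m (val v); last first.
    by exists m; rewrite ?inE ?mv ?lepm_refl.
  by exists (val u) => //; rewrite !inE val_eqE neq_uv; apply: valP.
by rewrite !inE => /andP[_ mG]; exists m; rewrite ?lepm_refl.
Qed.

Lemma TObsL_eq0 (n : nat) (G : {fset 'X_{1..n}}) :
  TObsL G = 0%N <-> exists r : {set G * G}, total_order r /\ ObsL r = 0%N.
Proof.
rewrite /TObsL; case: ex_minnP => k /existsP[r /andP[hr /eqP rk]] kmin.
split=> [k0|[r' [hr' r'0]]]; first by exists r; rewrite rk.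
by apply/eqP; rewrite -leqn0 kmin //; apply/existsP; exists r'; rewrite hr' r'0.
Qed.

Theorem theorem5p4 (K : fieldType) (n : nat) (I : {mpoly K[n]} -> Prop)
    (hI : monomial_ideal I) :
  lyubeznik_ideal I <-> TObsL (mingens I) = 0%N.
Proof.
have minG := mingensP hI; have anti := mingens_antichain minG.
rewrite TObsL_eq0; split=> -[r [hr]].
  by case=> _ dmm; exists r; split=> //; apply/(minimal_ObsL_eq0 K hr anti).
move=> /(minimal_ObsL_eq0 K hr anti) dmm; exists r; split=> //.
by split=> //; apply: Lyubeznik_resolution hr minG.1.
Qed.
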